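(* Let $A$ be a Marot ring. If $A$ is a $P$-ring, then $A$ is perinormal.
   Context: All rings are commutative with unity. For a ring $A$, $\mathrm{Reg}(A)$ is the set of regular elements (non-zero-divisors) of $A$, and the total quotient ring $K$ of $A$ is the fraction ring of $A$ with denominators in $\mathrm{Reg}(A)$. An ideal of $A$ is regular if it contains a regular element. $A$ is a Marot ring if every regular ideal of $A$ is generated by regular elements. An overring of $A$ is a ring $B$ with $A\subseteq B\subseteq K$. A ring extension $A\subseteq B$ satisfies going down if, whenever $P_1\subseteq P_2$ are prime ideals of $A$ and $Q_2$ is a prime ideal of $B$ with $Q_2\cap A=P_2$, there is a prime ideal $Q_1\subseteq Q_2$ of $B$ with $Q_1\cap A=P_1$. A GD-overring of $A$ is an overring $B$ of $A$ such that $A\subseteq B$ satisfies going down. A ring $A$ is perinormal if every GD-overring of $A$ is flat as an $A$-module. For a prime ideal $P$ of $A$, the regular quotient ring $A_{(P)}$ is the fraction ring of $A$ with denominators in $(A-P)\cap \mathrm{Reg}(A)$; it is an overring of $A$. A valuation on a ring $K$ is a surjective map $v:K\rightarrow G\cup\{\infty\}$, with $(G,+)$ a totally ordered abelian group, such that $v(xy)=v(x)+v(y)$ and $v(x+y)\geq\min\{v(x),v(y)\}$ for all $x,y\in K$, $v(1)=0$ and $v(0)=\infty$. If $A$ has total quotient ring $K$ and $M$ is a prime ideal of $A$, then $(A,M)$ is a valuation pair if there is a valuation $v$ on $K$ with $A=\{x\in K\mid v(x)\geq 0\}$ and $M=\{x\in K\mid v(x)>0\}$ (equivalently: for every $x\in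 K-A$ there is $y\in M$ with $xy\in A-M$; equivalently: every overring $B$ of $A$ having a prime ideal $N$ with $N\cap A=M$ equals $A$). A regular prime ideal $P$ of $A$ is valued if $(A_{(P)},PA_{(P)})$ is a valuation pair. $\mathrm{Ass}(K/A)$ is the set of prime ideals $P$ of $A$ for which there exist $a\in A$ and $b\in\mathrm{Reg}(A)$ such that $P$ is minimal over $bA:a=\{x\in A\mid xa\in bA\}$ (all such $P$ are regular). $A$ is a $P$-ring if every $Q\in \mathrm{Ass}(K/A)$ is valued. *)

(* Defs.v *)
From HB Require Import structures.
From mathcomp Require Import all_boot all_order all_algebra.
From mathcomp Require Import generic_quotient.
From mathcomp Require Import boolp classical_sets.

Set Implicit Arguments.
Unset Strict Implicit.
Unset Printing Implicit Defensive.

Import Order.TTheory GRing.Theory Num.Theory.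
Local Open Scope classical_set_scope.
Local Open Scope quotient_scope.
Local Open Scope ring_scope.

(* Rings are commutative with unity, the zero ring being allowed
   (comPzRingType). Regular elements are the x with GRing.lreg x. *)

Section Ideals.
Variable A : comPzRingType.
Implicit Types (I P S T : set A).

Definition is_ideal I : Prop :=
  [/\ I 0, (forall x y, I x -> I y -> I (x + y))
    & (forall a x, I x -> I (a * x))].

Definition is_prime_ideal P : Prop :=
  [/\ is_ideal P, ~ P 1 & forall x y, P (x * y) -> P x \/ P y].

Definition regular_ideal I : Prop := exists2 x, I x & GRing.lreg x.

(* The S-linear combinations of elements of T: the ideal generated by T when
   S = setT, and the ideal of S generated by T when S is a subring
   containing T. *)
Definition lin_span S T : set A :=
  [set x | exists (n : nat) (c r : 'I_n -> A),
     [/\ forall k, S (c k), forall k, T (r k) & x = \sum_(k < n) c k * r k]].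

Definition marot : Prop :=
  forall I, is_ideal I -> regular_ideal I ->
    exists2 T, T `<=` [set x | GRing.lreg x] & I = lin_span setT T.

Definition minimal_prime_over I P : Prop :=
  [/\ is_prime_ideal P, I `<=` P
    & forall Q, is_prime_ideal Q -> I `<=` Q -> Q `<=` P -> Q = P].

(* bA : a *)
Definition colon_principal (b a : A) : set A :=
  [set x | exists y, x * a = b * y].

(* P \in Ass(K/A) *)
Definition ass_total_quotient P : Prop :=
  exists a b, GRing.lreg b /\ minimal_prime_over (colon_principal b a) P.

End Ideals.

(* None stands for infinity. *)
Section ValueGroup.
Variable G : porderZmodType.

Definition vadd (x y : option G) : option G :=
  if x is Some g then if y is Some h then Some (g + h) else None else None.

Definition vle (x y : option G) : bool :=
  match x, y with
  | _, None => true
  | None, Some _ => false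
  | Some g, Some h => g <= h
  end.

Definition vlt (x y : option G) : bool := vle x y && (x != y).

Definition vmin (x y : option G) : option G := if vle x y then x else y.

End ValueGroup.

(* In a porderZmodType the order is an arbitrary partial order, hence the
   requirements of totality and translation invariance. *)
Definition totally_ordered_group (G : porderZmodType) : Prop :=
  (forall x y : G, (x <= y) || (y <= x)) /\
  (forall x y z : G, y <= z -> x + y <= x + z).

Definition is_valuation (K : comPzRingType) (G : porderZmodType)
    (v : K -> option G) : Prop :=
  [/\ totally_ordered_group G,
      (forall g, exists x, v x = g),
      (forall x y, v (x * y) = vadd (v x) (v y)),
      (forall x y, vle (vmin (v x) (v y)) (v (x + y)))
    & v 1 = Some 0 /\ v 0 = None].

(* C is a subring of K and M a subset of C. That M is a prime ideal of C
   follows from the definition. *)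
Definition valuation_pair (K : comPzRingType) (C M : set K) : Prop :=
  exists (G : porderZmodType) (v : K -> option G),
    [/\ is_valuation v,
        C = [set x | vle (Some 0) (v x)]
      & M = [set x | vlt (Some 0) (v x)]].

(* i : A -> K exhibits K as the total quotient ring of A. *)
Definition is_total_quotient_ring (A K : comPzRingType)
    (i : {rmorphism A -> K}) : Prop :=
  [/\ injective i,
      (forall s, GRing.lreg s -> exists t, i s * t = 1)
    & (forall x, exists a s, GRing.lreg s /\ x * i s = i a)].

Section TotalQuotient.
Variables (A K : comPzRingType) (i : {rmorphism A -> K}).

(* A_(P), as a subring of K *)
Definition regular_quotient_ring (P : set A) : set K :=
  [set x | exists a s, [/\ ~ P s, GRing.lreg s & x * i s = i a]].

Definition valued (P : set A) : Prop :=
  [/\ is_prime_ideal P, regular_ideal P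
    & valuation_pair (regular_quotient_ring P)
                     (lin_span (regular_quotient_ring P) (i @` P))].

Definition P_ring : Prop := forall P, ass_total_quotient P -> valued P.

(* An overring is a ring B with injections A -> B -> K composing to i. *)
Definition is_overring (B : comPzRingType) (j : {rmorphism A -> B})
    (k : {rmorphism B -> K}) : Prop :=
  [/\ injective j, injective k & forall a, k (j a) = i a].

End TotalQuotient.

Definition going_down (A B : comPzRingType) (j : {rmorphism A -> B}) : Prop :=
  forall (P1 P2 : set A) (Q2 : set B),
    is_prime_ideal P1 -> is_prime_ideal P2 -> P1 `<=` P2 ->
    is_prime_ideal Q2 -> j @^-1` Q2 = P2 ->
    exists Q1 : set B, [/\ is_prime_ideal Q1, Q1 `<=` Q2 & j @^-1` Q1 = P1].

(* The tensor product of two A-modules is constructed as the finite formal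
   sums of pairs (represented by sequences) modulo the congruence generated by
   the bilinearity relations. *)
Section Tensor.
Variables (A : comPzRingType) (M N : lmodType A).

Inductive tensor_rel : seq (M * N) -> seq (M * N) -> Prop :=
| tensor_refl s : tensor_rel s s
| tensor_sym s t : tensor_rel s t -> tensor_rel t s
| tensor_trans t s u : tensor_rel s t -> tensor_rel t u -> tensor_rel s u
| tensor_cat s s' t t' :
    tensor_rel s s' -> tensor_rel t t' -> tensor_rel (s ++ t) (s' ++ t')
| tensor_catC s t : tensor_rel (s ++ t) (t ++ s)
| tensor_0l n : tensor_rel [:: (0, n)] [::]
| tensor_Dl m m' n : tensor_rel [:: (m + m', n)] [:: (m, n); (m', n)]
| tensor_Dr m n n' : tensor_rel [:: (m, n + n')] [:: (m, n); (m, n')]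
| tensor_Z a m n : tensor_rel [:: (a *: m, n)] [:: (m, a *: n)].

Definition tensor_relb (s t : seq (M * N)) : bool := `[< tensor_rel s t >].

Lemma tensor_relb_refl : reflexive tensor_relb.
Proof. by move=> s; apply/asboolP; exact: tensor_refl. Qed.

Lemma tensor_relb_sym : symmetric tensor_relb.
Proof. by move=> s t; apply/asboolP/asboolP; exact: tensor_sym. Qed.

Lemma tensor_relb_trans : transitive tensor_relb.
Proof.
by move=> t s u /asboolP st /asboolP tu; apply/asboolP; exact: tensor_trans tu.
Qed.

Canonical tensor_equiv :=
  EquivRel tensor_relb tensor_relb_refl tensor_relb_sym tensor_relb_trans.

Definition tensor : Type := {eq_quot tensor_equiv}.
HB.instance Definition _ := Choice.on tensor.
HB.instance Definition _ := EqQuotient.on tensor.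

Lemma tensorP (s t : seq (M * N)) :
  \pi_tensor s = \pi_tensor t <-> tensor_rel s t.
Proof. by split=> [/eqmodP/asboolP|st] //; apply/eqmodP/asboolP. Qed.

Lemma tensor_repr (s : seq (M * N)) :
  tensor_rel (repr (\pi_tensor s)) s.
Proof. by apply/tensorP; rewrite reprK. Qed.

Lemma tensorW (Q : tensor -> Prop) :
  (forall s : seq (M * N), Q (\pi_tensor s)) -> forall x, Q x.
Proof. by move=> Qpi x; rewrite -[x]reprK; exact: Qpi. Qed.

Definition tensor_scale_seq (a : A) (s : seq (M * N)) :=
  [seq (a *: p.1, p.2) | p <- s].

Lemma tensor_scale_rel a s t :
  tensor_rel s t -> tensor_rel (tensor_scale_seq a s) (tensor_scale_seq a t).
Proof.
elim=> /=; rewrite /tensor_scale_seq /=.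
- by move=> ?; exact: tensor_refl.
- by move=> ? ? _; exact: tensor_sym.
- by move=> t' ? ? _ + _; exact: tensor_trans.
- by move=> ? ? ? ? _ ? _ ?; rewrite !map_cat; exact: tensor_cat.
- by move=> ? ?; rewrite !map_cat; exact: tensor_catC.
- by move=> n; rewrite scaler0; exact: tensor_0l.
- by move=> m m' n; rewrite scalerDr; exact: tensor_Dl.
- by move=> m n n'; exact: tensor_Dr.
- move=> b m n; rewrite scalerA mulrC -scalerA; exact: tensor_Z.
Qed.

Definition tensor_zero : tensor := \pi_tensor [::].
Definition tensor_add (x y : tensor) : tensor := \pi_tensor (repr x ++ repr y).
Definition tensor_scale (a : A) (x : tensor) : tensor :=
  \pi_tensor (tensor_scale_seq a (repr x)).
Definition tensor_opp (x : tensor) : tensor := tensor_scale (-1) x.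

Lemma tensor_addE s t :
  tensor_add (\pi_tensor s) (\pi_tensor t) = \pi_tensor (s ++ t).
Proof. by apply/tensorP; apply: tensor_cat; exact: tensor_repr. Qed.

Lemma tensor_scaleE a s :
  tensor_scale a (\pi_tensor s) = \pi_tensor (tensor_scale_seq a s).
Proof. by apply/tensorP; apply: tensor_scale_rel; exact: tensor_repr. Qed.

Lemma tensor_addA : associative tensor_add.
Proof.
by elim/tensorW=> s; elim/tensorW=> t; elim/tensorW=> u; rewrite !tensor_addE catA.
Qed.

Lemma tensor_addC : commutative tensor_add.
Proof.
elim/tensorW=> s; elim/tensorW=> t; rewrite !tensor_addE.
by apply/tensorP; exact: tensor_catC.
Qed.

Lemma tensor_add0 : left_id tensor_zero tensor_add.
Proof. by elim/tensorW=> s; rewrite tensor_addE. Qed.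

Lemma tensor_scaleDl_rel a b s :
  tensor_rel (tensor_scale_seq (a + b) s)
             (tensor_scale_seq a s ++ tensor_scale_seq b s).
Proof.
elim: s => [|[m n] s IH] /=; first exact: tensor_refl.
set sa := tensor_scale_seq a s; set sb := tensor_scale_seq b s.
apply: (@tensor_trans ([:: (a *: m, n); (b *: m, n)] ++ (sa ++ sb))).
  by rewrite scalerDl; apply: (tensor_cat (tensor_Dl _ _ _) IH).
apply: (tensor_cat (tensor_refl [:: (a *: m, n)])).
rewrite -cat1s -[_ :: sb]cat1s !catA.
exact: (tensor_cat (tensor_catC _ _) (tensor_refl sb)).
Qed.

Lemma tensor_scale0_rel s : tensor_rel (tensor_scale_seq 0 s) [::].
Proof.
elim: s => [|[m n] s IH] /=; first exact: tensor_refl.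
rewrite scale0r; exact: (tensor_cat (tensor_0l n) IH).
Qed.

Lemma tensor_scale1 : left_id 1 tensor_scale.
Proof.
elim/tensorW=> s; rewrite tensor_scaleE; congr (\pi _).
by rewrite -[RHS]map_id; apply: eq_map => -[m n] /=; rewrite scale1r.
Qed.

Lemma tensor_scaleDl (x : tensor) :
  {morph tensor_scale^~ x : a b / a + b >-> tensor_add a b}.
Proof.
elim/tensorW: x => s a b; rewrite !tensor_scaleE tensor_addE.
by apply/tensorP; exact: tensor_scaleDl_rel.
Qed.

Lemma tensor_addN : left_inverse tensor_zero tensor_opp tensor_add.
Proof.
move=> x; rewrite -{2}[x]tensor_scale1 -tensor_scaleDl addNr.
by elim/tensorW: x => s; rewrite tensor_scaleE; apply/tensorP;
  exact: tensor_scale0_rel.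
Qed.

HB.instance Definition _ := GRing.isZmodule.Build tensor
  tensor_addA tensor_addC tensor_add0 tensor_addN.

Lemma tensor_scaleA a b (x : tensor) :
  tensor_scale a (tensor_scale b x) = tensor_scale (a * b) x.
Proof.
elim/tensorW: x => s; rewrite !tensor_scaleE /tensor_scale_seq -map_comp.
congr (\pi _).
by apply: eq_map => -[m n] /=; rewrite scalerA.
Qed.

Lemma tensor_scaleDr : right_distributive tensor_scale +%R.
Proof.
move=> a; elim/tensorW=> s; elim/tensorW=> t.
by rewrite -![_ + _]/(tensor_add _ _) tensor_addE !tensor_scaleE tensor_addE
  -map_cat.
Qed.

HB.instance Definition _ := GRing.Zmodule_isLmodule.Build A tensor
  tensor_scaleA tensor_scale1 tensor_scaleDr tensor_scaleDl.

End Tensor.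

(* f (x) id_N *)
Definition tensor_map (A : comPzRingType) (M M' N : lmodType A)
    (f : {linear M -> M'}) (x : tensor M N) : tensor M' N :=
  \pi_(tensor M' N) [seq (f p.1, p.2) | p <- repr x].

Lemma tensor_map_rel (A : comPzRingType) (M M' N : lmodType A)
    (f : {linear M -> M'}) (s t : seq (M * N)) : tensor_rel s t ->
  tensor_rel [seq (f p.1, p.2) | p <- s] [seq (f p.1, p.2) | p <- t].
Proof.
elim=> {s t} /=.
- by move=> ?; exact: tensor_refl.
- by move=> ? ? _; exact: tensor_sym.
- by move=> t' ? ? _ + _; exact: tensor_trans.
- by move=> ? ? ? ? _ ? _ ?; rewrite !map_cat; exact: tensor_cat.
- by move=> ? ?; rewrite !map_cat; exact: tensor_catC.
- by move=> n; rewrite linear0; exact: tensor_0l.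
- by move=> m m' n; rewrite linearD; exact: tensor_Dl.
- by move=> m n n'; exact: tensor_Dr.
- by move=> b m n; rewrite linearZ; exact: tensor_Z.
Qed.

Lemma tensor_mapE (A : comPzRingType) (M M' N : lmodType A)
    (f : {linear M -> M'}) (s : seq (M * N)) :
  tensor_map f (\pi_(tensor M N) s) =
  \pi_(tensor M' N) [seq (f p.1, p.2) | p <- s].
Proof. by apply/tensorP; apply: tensor_map_rel; exact: tensor_repr. Qed.

Definition flat (A : comPzRingType) (N : lmodType A) : Prop :=
  forall (M M' : lmodType A) (f : {linear M -> M'}),
    injective f -> injective (@tensor_map A M M' N f).

(* B as an A-module by restriction of scalars along j. *)
Section RestrictScalars.
Variables (A B : comPzRingType) (j : {rmorphism A -> B}).

Definition restrict_scalars : Type := let _ := j in B.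
HB.instance Definition _ := GRing.Zmodule.on restrict_scalars.

Definition restrict_scale (a : A) (x : restrict_scalars) : restrict_scalars :=
  j a * (x : B).

Lemma restrict_scaleA a b (x : restrict_scalars) :
  restrict_scale a (restrict_scale b x) = restrict_scale (a * b) x.
Proof. by rewrite /restrict_scale rmorphM mulrA. Qed.

Lemma restrict_scale1 : left_id 1 restrict_scale.
Proof. by move=> x; rewrite /restrict_scale rmorph1 mul1r. Qed.

Lemma restrict_scaleDr : right_distributive restrict_scale +%R.
Proof. by move=> a x y; rewrite /restrict_scale mulrDr. Qed.

Lemma restrict_scaleDl (x : restrict_scalars) :
  {morph restrict_scale^~ x : a b / a + b}.
Proof. by move=> a b; rewrite /restrict_scale rmorphD mulrDl. Qed.

HB.instance Definition _ := GRing.Zmodule_isLmodule.Build A restrict_scalars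
  restrict_scaleA restrict_scale1 restrict_scaleDr restrict_scaleDl.

End RestrictScalars.

Definition perinormal (A K : comPzRingType) (i : {rmorphism A -> K}) : Prop :=
  forall (B : comPzRingType) (j : {rmorphism A -> B}) (k : {rmorphism B -> K}),
    is_overring i j k -> going_down j -> flat (restrict_scalars j).

(* Main.v *)
Require Import Defs.
From HB Require Import structures.
From mathcomp Require Import all_boot all_order all_algebra ring.
From mathcomp Require Import generic_quotient boolp classical_sets.

(** Let [B] be a GD-overring of [A], [N] a prime of [B] and [x] in [B]. Write
    [x = a / b]. If [bA : a] were contained in the contraction of [N], then a
    minimal prime [Q] of [bA : a] inside this contraction would be valued, and
    by going down it would be the contraction of a prime of [B]. As [A_(Q)] is
    a valuation ring with center [Q], it is maximal among the rings with a
    prime contracting to [Q], so it contains [x]; but then some element of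
    [bA : a] lies outside [Q]. Hence every [x] in [B] has a multiplier [t] in
    [A], outside [N], with [t x] in [A]: this says that [A] and [B] have the
    same localizations at [N], so [B] is flat. *)

Set Implicit Arguments.
Unset Strict Implicit.
Unset Printing Implicit Defensive.

Import Order.TTheory GRing.Theory Num.Theory.
Local Open Scope classical_set_scope.
Local Open Scope quotient_scope.
Local Open Scope ring_scope.

(** * Zorn's lemma and the existence of prime ideals *)

(** [Zorn_bigcup] also tests the empty chain, whose union is [set0]. Adjoining [set0] to the family
    absorbs this case; if [set0] itself comes out maximal, it equals [X0]. *)
Lemma Zorn_bigcup_nonempty (T : Type) (P : set (set T)) (X0 : set T) : P X0 ->
  (forall F : set (set T), F !=set0 -> F `<=` P -> total_on F subset ->
    P (\bigcup_(X in F) X)) ->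
  exists2 X, P X & forall Y, P Y -> X `<=` Y -> Y = X.
Proof.
move=> PX0 chainP.
have [F FP Ftot|X [PX Xmax]] := @Zorn_bigcup T [set X | X = set0 \/ P X].
  have [[X FX PX]|noP] := pselect (exists2 X, F X & P X); last first.
    left; apply/seteqP; split=> // z [X FX Xz].
    case: (FP _ FX) => [X0E|PX]; first by rewrite X0E in Xz.
    by case: noP; exists X.
  right; suff -> : \bigcup_(X in F) X = \bigcup_(X in F `&` P) X.
    apply: chainP => [|Y [] //|Y Z [FY _] [FZ _]]; first by exists X.
    exact: Ftot.
  apply/seteqP; split=> z [Y FY Yz]; last by exists Y => //; case: FY.
  exists Y => //; split=> //.
  by case: (FP _ FY) => // Y0; rewrite Y0 in Yz.
have maxX Y : P Y -> X `<=` Y -> Y = X.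
  move=> PY XY; have [//|neq] := pselect (Y = X).
  case: (Xmax Y); last by right.
  by split=> // YX; apply: neq; apply/seteqP.
case: PX => [X0E|PX]; last by exists X.
exists X => //; suff <- : X0 = X by [].
by apply: maxX => //; rewrite X0E.
Qed.

Section PrimeIdeals.
Variable A : comPzRingType.
Implicit Types (I P Q : set A).

Lemma exists_prime_over I : is_ideal I -> ~ I 1 ->
  exists2 P, is_prime_ideal P & I `<=` P.
Proof.
move=> idI I1.
have [||P [idP IP P1] maxP] :=
  @Zorn_bigcup_nonempty A [set J | [/\ is_ideal J, I `<=` J & ~ J 1]] I.
- by split.
- move=> F [J0 FJ0] FP Ftot; split; first split.
  + by exists J0 => //; case: (FP _ FJ0) => -[].
  + move=> x y [J FJ Jx] [J' FJ' Jy].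
    have [JJ'|J'J] := Ftot _ _ FJ FJ'.
    * exists J' => //; case: (FP _ FJ') => -[_ addJ' _] _ _.
      by apply: addJ' => //; apply: JJ'.
    * exists J => //; case: (FP _ FJ) => -[_ addJ _] _ _.
      by apply: addJ => //; apply: J'J.
  + move=> a x [J FJ Jx]; exists J => //.
    by case: (FP _ FJ) => -[_ _ mulJ] _ _; apply: mulJ.
  + by move=> x Ix; exists J0 => //; case: (FP _ FJ0) => _ + _; apply.
  + by move=> [J FJ]; case: (FP _ FJ).
have [P0 addP mulP] := idP.
exists P => //; split=> // x y Pxy.
(* If [x] is invertible modulo [P], then [y] lies in [P]. Otherwise the ideal [J] generated by [P]
   and [x] is proper, hence equal to [P] by maximality. *)
have [[b P1xb]|nex] := pselect (exists b, P (1 - x * b)).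
  right; have -> : y = y * (1 - x * b) + b * (x * y).
    by ring.
  by apply: addP; apply: mulP.
left; pose J := [set z | exists b, P (z - x * b)].
suff <- : J = P by exists 1; rewrite mulr1 subrr.
apply: maxP => [|z Pz]; last by exists 0; rewrite mulr0 subr0.
split; first split.
- by exists 0; rewrite mulr0 subr0.
- by move=> z w [b Pb] [c Pc]; exists (b + c); rewrite mulrDr opprD addrACA;
    apply: addP.
- by move=> c z [b Pb]; exists (c * b); rewrite mulrCA -mulrBr; apply: mulP.
- by move=> z /IP Pz; exists 0; rewrite mulr0 subr0.
- by move=> [b Pb]; apply: nex; exists b.
Qed.

(** Zorn's lemma is applied to complements of primes, so that the intersection of a chain of primes
    becomes a union. *)
Lemma exists_minimal_prime I P : is_prime_ideal P -> I `<=` P ->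
  exists2 Q, minimal_prime_over I Q & Q `<=` P.
Proof.
move=> prP IP.
have [||X [prQ IQ QP] maxX] := @Zorn_bigcup_nonempty A
  [set X | [/\ is_prime_ideal (~` X), I `<=` ~` X & ~` X `<=` P]] (~` P).
- by rewrite /= setCK; split.
- move=> F [X0 FX0] FP Ftot; split; first split; first split.
  + by move=> [X FX]; case: (FP _ FX) => -[[X0' _ _] _ _] _ _; exact: X0'.
  + move=> x y nx ny [X FX]; case: (FP _ FX) => -[[_ addX _] _ _] _ _.
    by apply: addX => ?; [apply: nx|apply: ny]; exists X.
  + move=> a x nx [X FX]; case: (FP _ FX) => -[[_ _ mulX] _ _] _ _.
    by apply: mulX => ?; apply: nx; exists X.
  + move=> n1; case: (FP _ FX0) => -[_ + _] _ _; apply=> X01.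
    by apply: n1; exists X0.
  + move=> x y nxy.
    have [[X FX Xx]|] := pselect ((\bigcup_(X in F) X) x); last by left.
    have [[Y FY Yy]|] := pselect ((\bigcup_(X in F) X) y); last by right.
    have [Z FZ [Zx Zy]] : exists2 Z, F Z & Z x /\ Z y.
      by have [XY|YX] := Ftot _ _ FX FY; [exists Y|exists X] => //; split=> //;
        [apply: XY|apply: YX].
    case: (FP _ FZ) => -[_ _ prZ] _ _.
    have /prZ[] : (~` Z) (x * y) by move=> Zxy; apply: nxy; exists Z.
      by move=> /(_ Zx).
    by move=> /(_ Zy).
  + by move=> x Ix [X FX]; case: (FP _ FX) => _ + _; apply.
  + move=> x nx; case: (FP _ FX0) => _ _; apply=> X0x.
    by apply: nx; exists X0.
exists (~` X) => //; split=> // Q prQ' IQ' QX.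
rewrite -(maxX (~` Q)) ?setCK //; first by split; rewrite ?setCK // => x /QX /QP.
by rewrite -[X in X `<=` _]setCK; apply: subsetC.
Qed.

Lemma prime_notM P x y : is_prime_ideal P -> ~ P x -> ~ P y -> ~ P (x * y).
Proof. by move=> [_ _ prP] nx ny /prP[]. Qed.

Lemma prime_preimage (B : comPzRingType) (j : {rmorphism A -> B}) (N : set B) :
  is_prime_ideal N -> is_prime_ideal (j @^-1` N).
Proof.
move=> [[N0 addN mulN] N1 prN]; split; first split.
- by rewrite /preimage /= rmorph0.
- by move=> x y Nx Ny; rewrite /preimage /= rmorphD; apply: addN.
- by move=> a x Nx; rewrite /preimage /= rmorphM; apply: mulN.
- by rewrite /preimage /= rmorph1.
- by move=> x y; rewrite /preimage /= rmorphM => /prN.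
Qed.

End PrimeIdeals.

(** * Units and values in a valuation pair *)

Section ValuationPairs.
Variables (K : comPzRingType) (C M : set K).
Hypothesis CM : valuation_pair C M.

(** The values of [u] and [w] are nonnegative with sum 0, so both vanish. *)
Lemma valuation_pair_unit u w : C u -> C w -> u * w = 1 -> ~ M u.
Proof.
have [G [v [[[_ trG] _ vM _ [v1 _]] -> ->]]] := CM.
move=> /= Cu Cw uw1 Mu.
have := vM u w; rewrite uw1 v1.
case: (v u) Cu Mu => [g|] //; case: (v w) Cw => [h|] //=.
move=> h0 _ /andP[/= g0 gn0] [gh0]; move/negP: gn0; apply.
apply/eqP; congr Some; apply/eqP; rewrite eq_le g0 /=.
by have := trG g _ _ h0; rewrite addr0 -gh0.
Qed.

Lemma valuation_pair_mul_notin x y : C x -> ~ M x -> C y -> ~ M y ->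
  ~ M (x * y).
Proof.
have [G [v [[_ _ vM _ _] -> ->]]] := CM.
have vE z : vle (Some 0) (v z) -> ~ vlt (Some 0) (v z) -> v z = Some 0.
  by rewrite /vlt => ->; rewrite andTb => /negP/negPn/eqP.
move=> /= Cx Mx Cy My; rewrite vM (vE _ Cx Mx) (vE _ Cy My) /= addr0.
by rewrite /vlt eqxx andbF.
Qed.

Lemma valuation_pair_shift x : ~ C x -> exists2 y, M y & C (x * y) /\ ~ M (x * y).
Proof.
have [G [v [[[totG trG] surjv vM _ _] -> ->]]] := CM.
rewrite /=; case vx: (v x) => [g|] //= ng0.
(* Here [g] is negative, so [y] has positive value and [x * y] has value 0. *)
have [y vy] := surjv (Some (- g)); exists y; last first.
  by rewrite vM vx vy /= subrr /vlt /= lexx eqxx.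
have /orP[//|g0] := totG 0 g.
rewrite vy /vlt /=; apply/andP; split.
  by have := trG (- g) _ _ g0; rewrite addNr addr0.
by apply/eqP => -[/eqP]; rewrite eq_sym oppr_eq0 => /eqP gE; rewrite gE lexx in ng0.
Qed.

End ValuationPairs.

(** * Regular quotient rings and valued primes *)

Section RegularQuotient.
Variables (A K : comPzRingType) (i : {rmorphism A -> K}).
Variable P : set A.
Hypothesis prP : is_prime_ideal P.

Let notP1 : ~ P 1. Proof. by case: prP. Qed.

Lemma regular_quotient_ring_image a : regular_quotient_ring i P (i a).
Proof. by exists a, 1; split; [|exact: lreg1|rewrite rmorph1 mulr1]. Qed.

Lemma regular_quotient_ring_inv s t : GRing.lreg s -> ~ P s -> i s * t = 1 ->
  regular_quotient_ring i P t.
Proof. by move=> rs Ps st; exists 1, s; rewrite mulrC st rmorph1. Qed.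

(** Common denominators exist, because the regular elements outside [P] are closed under
    products. *)
Lemma lin_span_regular_quotient y :
  lin_span (regular_quotient_ring i P) (i @` P) y ->
  exists q s, [/\ P q, ~ P s, GRing.lreg s & y * i s = i q].
Proof.
have [[P0 addP mulP] _ _] := prP.
move=> [n [c [r [Sc Pr ->]]]]; elim/big_rec: _ => [|k y' _ [q [s [Pq Ps rs ysE]]]].
  by exists 0, 1; split=> //; [exact: lreg1|rewrite mul0r rmorph0].
have [a [s' [Ps' rs' cE]]] := Sc k; have [p Pp rE] := Pr k.
exists (s * a * p + s' * q), (s * s'); split.
- by apply: addP; apply: mulP.
- exact: prime_notM.
- exact: lregM.
- by rewrite -rE rmorphD !rmorphM -cE -ysE; ring.
Qed.

End RegularQuotient.

(** Otherwise some [y] in the center of the valuation makes [k x * y] of value 0. Clearing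
    denominators inside [B], the numerator of [k x * y] falls into [N], hence into [Q], which forces
    a positive value. *)
Lemma valued_dominates (A K B : comPzRingType) (i : {rmorphism A -> K})
    (j : {rmorphism A -> B}) (k : {rmorphism B -> K})
    (Q : set A) (N : set B) :
  is_total_quotient_ring i -> is_overring i j k -> valued i Q ->
  is_prime_ideal N -> j @^-1` N = Q ->
  forall x : B, regular_quotient_ring i Q (k x).
Proof.
move=> hK [injj injk kj] [prQ _ VQ] prN NQ x.
have [[N0 addN mulN] _ _] := prN.
have [_ invK _] := hK.
have imC := regular_quotient_ring_image i prQ.
have unitM s : ~ Q s -> GRing.lreg s ->
    ~ lin_span (regular_quotient_ring i Q) (i @` Q) (i s).
  move=> Qs rs; have [t st] := invK s rs.
  by apply: (valuation_pair_unit VQ (imC s) _ st);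
    exact: regular_quotient_ring_inv st.
have [//|nCx] := pselect (regular_quotient_ring i Q (k x)).
have [y My [Cxy Mxy]] := valuation_pair_shift VQ nCx.
have [q [s [Qq Qs rs ysE]]] := lin_span_regular_quotient prQ My.
have [a [s' [Qs' rs' xyE]]] := Cxy.
have aE : j a * j s = j s' * (x * j q).
  by apply: injk; rewrite !rmorphM !kj -xyE -ysE; ring.
exfalso; have : N (j (a * s)).
  rewrite rmorphM aE; apply/mulN/mulN.
  by have := Qq; rewrite -NQ.
have [_ _ prQM] := prQ.
move=> Nas; have /prQM[Qa|//] : Q (a * s) by rewrite -NQ.
(* Both [k x * y] and [i s'] lie outside the center, but their product [i a] lies in it since [a] is
   in [Q]. *)
apply: (valuation_pair_mul_notin VQ Cxy Mxy (imC s') (unitM _ Qs' rs')).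
rewrite xyE; exists 1%N, (fun=> 1), (fun=> i a); split.
- by move=> _; rewrite -(rmorph1 i); exact: imC.
- by move=> _; exists a.
- by rewrite big_ord1 mul1r.
Qed.

Lemma GD_overring_multiplier (A K B : comPzRingType) (i : {rmorphism A -> K})
    (j : {rmorphism A -> B}) (k : {rmorphism B -> K}) :
  is_total_quotient_ring i -> P_ring i -> is_overring i j k -> going_down j ->
  forall N, is_prime_ideal N ->
  forall x : B, exists t a, ~ N (j t) /\ j t * x = j a.
Proof.
move=> hK hP ov GD N prN x.
have [injj injk kj] := ov; have [inji invK frac] := hK.
have [a [b [rb xbE]]] := frac (k x).
have [b' bb'] := invK b rb.
have colonE s c : s * a = b * c -> j s * x = j c.
  move=> sac; apply: injk; rewrite rmorphM !kj.
  have -> : k x = i a * b' by rewrite -xbE -mulrA bb' mulr1.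
  by rewrite mulrA -rmorphM sac rmorphM mulrAC bb' mul1r.
have [//|nex] := pselect (exists t a, ~ N (j t) /\ j t * x = j a).
have colonN : colon_principal b a `<=` j @^-1` N.
  move=> s [c sac]; have [//|Ns] := pselect (N (j s)).
  by case: nex; exists s, c; split=> //; exact: colonE.
have [Q minQ QN] := exists_minimal_prime (prime_preimage j prN) colonN.
have [prQ colonQ _] := minQ.
have valQ : valued i Q by apply: hP; exists a, b.
have [N' [prN' _ N'Q]] := GD _ _ _ prQ (prime_preimage j prN) QN prN erefl.
have [c [s [Qs rs xsE]]] := valued_dominates hK ov valQ prN' N'Q x.
(* From [x = a / b = c / s] follows [s * a = b * c], so the denominator [s] belongs to the colon
   ideal and thus to [Q]. *)
case: Qs; apply: colonQ; exists c; apply: inji.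
by rewrite !rmorphM -xbE -xsE; ring.
Qed.

(** * Flatness from local multipliers *)

Section LocalFlatness.
Variables (A B : comPzRingType) (j : {rmorphism A -> B}).
Hypothesis injj : injective j.

(* The fraction [t b], when it lies in [A]; otherwise the junk value 0, which
   [integral] below rules out. *)
Definition numer (t : A) (b : B) : A := xget 0 [set a | j t * b = j a].

Lemma numerE t b a : j t * b = j a -> numer t b = a.
Proof.
move=> tb; apply: xget_unique => // a' /=; rewrite tb => /esym; exact: injj.
Qed.

Definition integral (M : lmodType A) (t : A) (s : seq (M * restrict_scalars j)) :=
  all (fun p => `[< exists a, j t * (p.2 : B) = j a >]) s.

(** When [integral t s] holds, [t] times the tensor [s] is [value t s] tensor 1. *)
Definition value (M : lmodType A) (t : A) (s : seq (M * restrict_scalars j)) : M :=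
  \sum_(p <- s) numer t p.2 *: p.1.

Lemma valueM (M : lmodType A) c t (s : seq (M * restrict_scalars j)) :
  integral t s -> integral (c * t) s /\ value (c * t) s = c *: value t s.
Proof.
rewrite /integral /value; elim: s => [|p s IH] /=.
  by rewrite !big_nil scaler0.
move=> /andP[/asboolP[a tp] /IH[-> vE]]; rewrite !big_cons andbT vE scalerDr.
have ctp : j (c * t) * (p.2 : B) = j (c * a) by rewrite !rmorphM -mulrA tp.
by split; [apply/asboolP; exists (c * a)|rewrite (numerE tp) (numerE ctp) scalerA].
Qed.

Section AtPrime.
Variable N : set B.
Hypothesis prN : is_prime_ideal N.
Hypothesis multN : forall x : B, exists t a, ~ N (j t) /\ j t * x = j a.

Let notN1 : ~ N (j 1). Proof. by rewrite rmorph1; case: prN. Qed.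

Let notNM t u : ~ N (j t) -> ~ N (j u) -> ~ N (j (t * u)).
Proof. by rewrite rmorphM; exact: prime_notM. Qed.

Lemma common_multiplier (M : lmodType A) (s : seq (M * restrict_scalars j)) :
  exists2 t, ~ N (j t) & integral t s.
Proof.
elim: s => [|p s [t Nt its]]; first by exists 1.
have [u [a [Nu up]]] := multN p.2.
exists (u * t); first exact: notNM.
apply/andP; split; last exact: (valueM u its).1.
apply/asboolP; exists (t * a).
by rewrite !rmorphM -up; ring.
Qed.

(* Two representatives of a tensor become equal in [M] after multiplication by
   some [t] outside [N]: a substitute for localizing at [N]. *)
Lemma value_rel (M : lmodType A) (s u : seq (M * restrict_scalars j)) :
  tensor_rel s u ->
  exists2 t, ~ N (j t) & [/\ integral t s, integral t u & value t s = value t u].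
Proof.
elim=> {s u}.
- by move=> s; have [t Nt ts] := common_multiplier s; exists t.
- by move=> s u _ [t Nt [? ? ?]]; exists t.
- move=> w s u _ [t Nt [ts tw tE]] _ [t' Nt' [tw' tu tE']].
  (* The product of the two multipliers serves both relations; the values at the middle term [w] are
     then compared by commutativity. *)
  exists (t' * t); first exact: notNM.
  have [-> ->] := valueM t' ts; have [] := valueM t tu.
  rewrite mulrC => -> ->; split=> //.
  by rewrite tE -tE' -(valueM t' tw).2 -(valueM t tw').2 mulrC.
- move=> s s' u u' _ [t Nt [ts ts' tE]] _ [t' Nt' [tu tu' tE']].
  exists (t' * t); first exact: notNM.
  have [i1 v1] := valueM t' ts; have [i2 v2] := valueM t' ts'.
  have [i3 v3] := valueM t tu; have [i4 v4] := valueM t tu'.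
  rewrite /integral /value !all_cat !big_cat /=.
  rewrite -!/(integral _ _) -!/(value _ _) i1 i2 v1 v2 tE.
  by rewrite mulrC i3 i4 v3 v4 tE'.
- move=> s u; have [t Nt tsu] := common_multiplier (s ++ u).
  exists t => //; split=> //.
    by move: tsu; rewrite /integral !all_cat andbC.
  by rewrite /value !big_cat /= addrC.
- move=> n; have [t Nt tn] := common_multiplier [:: (0 : M, n)].
  by exists t => //; split=> //; rewrite /value big_seq1 big_nil scaler0.
- move=> m m' n; have [t Nt tn] := common_multiplier [:: (m, n)].
  move: tn; rewrite /integral /= andbT => tn.
  exists t => //; rewrite /integral /= !tn; split=> //.
  by rewrite /value !big_cons !big_nil !addr0 scalerDr.
- move=> m n n'; have [t Nt] := common_multiplier [:: (m, n); (m, n')].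
  rewrite /integral /= andbT => /andP[/asboolP[a tn] /asboolP[a' tn']].
  have tnn' : j t * (n + n' : B) = j (a + a') by rewrite mulrDr tn tn' rmorphD.
  exists t => //; rewrite /integral /= !andbT; split.
  + by apply/asboolP; exists (a + a').
  + by apply/andP; split; apply/asboolP; [exists a|exists a'].
  + rewrite /value !big_cons !big_nil !addr0 /=.
    by rewrite (numerE tn) (numerE tn') (numerE tnn') scalerDl.
- move=> a m n; have [t Nt] := common_multiplier [:: (m, n)].
  rewrite /integral /= andbT => /asboolP[c tn].
  have tan : j t * (a *: n : restrict_scalars j) = j (a * c).
    by rewrite [a *: n]/(j a * _) mulrCA tn rmorphM.
  exists t => //; rewrite /integral /= !andbT; split.
  + by apply/asboolP; exists c.
  + by apply/asboolP; exists (a * c).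
  + by rewrite /value !big_seq1 /= (numerE tn) (numerE tan) scalerA mulrC.
Qed.

End AtPrime.

(** The action of [B] on the tensor product through the second factor, on representatives. *)
Definition scale_right (M : lmodType A) (b : B) (s : seq (M * restrict_scalars j)) :=
  [seq (p.1, b * (p.2 : B) : restrict_scalars j) | p <- s].

Lemma scale_right_rel (M : lmodType A) b (s u : seq (M * restrict_scalars j)) :
  tensor_rel s u -> tensor_rel (scale_right b s) (scale_right b u).
Proof.
rewrite /scale_right; elim=> {s u} /=.
- by move=> ?; exact: tensor_refl.
- by move=> ? ? _; exact: tensor_sym.
- by move=> t' ? ? _ + _; exact: tensor_trans.
- by move=> ? ? ? ? _ ? _ ?; rewrite !map_cat; exact: tensor_cat.
- by move=> ? ?; rewrite !map_cat; exact: tensor_catC.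
- by move=> n; exact: tensor_0l.
- by move=> m m' n; exact: tensor_Dl.
- by move=> m n n'; rewrite mulrDr; exact: tensor_Dr.
- move=> a m n; rewrite [a *: n]/(j a * _) mulrCA.
  exact: (@tensor_Z A M (restrict_scalars j) a m (b * (n : B))).
Qed.

Lemma scale_rightD (M : lmodType A) b c (s : seq (M * restrict_scalars j)) :
  tensor_rel (scale_right (b + c) s) (scale_right b s ++ scale_right c s).
Proof.
apply/tensorP; elim: s => [//|[m n] s IH] /=.
rewrite -cat1s -tensor_addE IH -tensor_addE.
rewrite -[in RHS]cat1s -[_ :: scale_right c s]cat1s -!tensor_addE.
have -> : \pi_(tensor M (restrict_scalars j))
    [:: (m, (b + c) * (n : B) : restrict_scalars j)] =
  tensor_add (\pi [:: (m, b * (n : B) : restrict_scalars j)])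
             (\pi [:: (m, c * (n : B) : restrict_scalars j)]).
  by rewrite tensor_addE mulrDl; apply/tensorP; exact: tensor_Dr.
pose T := tensor M (restrict_scalars j).
exact: etrans (@addrACA T _ _ _ _) (esym (@addrA T _ _ _)).
Qed.

(** Each second component becomes the image of an element of [A], which moves across the tensor sign
    and leaves 1 behind. *)
Lemma scale_right_integral (M : lmodType A) t (s : seq (M * restrict_scalars j)) :
  integral t s ->
  tensor_rel (scale_right (j t) s) [:: (value t s, 1 : B)].
Proof.
rewrite /value; elim: s => [_|[m n] s IH] /=.
  by rewrite big_nil; apply/tensor_sym/tensor_0l.
move=> /andP[/asboolP[a /= tn] /IH sE]; rewrite big_cons /= (numerE tn) tn.
apply: (tensor_trans _ (tensor_sym (tensor_Dl _ _ _))).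
apply: (@tensor_cat _ _ _ [:: _] [:: _] _ [:: _] _ sE).
have aE : a *: ((1 : B) : restrict_scalars j) = j a by exact: mulr1.
by rewrite -aE; apply/tensor_sym/tensor_Z.
Qed.

Lemma flat_of_multipliers :
  (forall N, is_prime_ideal N ->
    forall x : B, exists t a, ~ N (j t) /\ j t * x = j a) ->
  flat (restrict_scalars j).
Proof.
move=> mult M M' f injf; elim/tensorW=> s; elim/tensorW=> u.
rewrite !tensor_mapE => /tensorP fsu; apply/tensorP.
(* [E] is the ideal of all [b] in [B] that equalize the two tensors; the goal is that it contains 1.
   If it were proper, it would lie in a prime [N]. *)
pose E := [set b | tensor_rel (scale_right b s) (scale_right b u)].
have scale_right0 (v : seq (M * restrict_scalars j)) :
    tensor_rel (scale_right 0 v) [::].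
  rewrite -(rmorph0 j); elim: v => [|[m n] v IH] /=; first exact: tensor_refl.
  apply: (@tensor_cat _ _ _ [:: _] [::] _ [::] _ IH).
  apply: tensor_trans (tensor_sym (tensor_Z 0 m n)) _.
  by rewrite scale0r; exact: tensor_0l.
have idE : is_ideal E.
  split.
  - exact: tensor_trans (scale_right0 s) (tensor_sym (scale_right0 u)).
  - move=> b c Eb Ec; apply: tensor_trans (scale_rightD _ _ _) _.
    apply: tensor_trans (tensor_cat Eb Ec) _.
    exact: tensor_sym (scale_rightD _ _ _).
  - move=> b c /(scale_right_rel b); rewrite /E /= /scale_right -!map_comp.
    by congr tensor_rel; apply: eq_map => p /=; rewrite mulrA.
have scale_right1 (v : seq (M * restrict_scalars j)) : scale_right 1 v = v.
  by rewrite -[RHS]map_id; apply: eq_map => -[m n] /=; rewrite mul1r.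
have [|nE1] := pselect (E 1); first by rewrite /E /= !scale_right1.
exfalso; have [N prN EN] := exists_prime_over idE nE1.
have [t Nt] := value_rel prN (mult N prN) fsu.
(* Integrality concerns second components only, which [f] leaves unchanged, so [t] also works for
   [s] and [u]. *)
rewrite /integral !all_map -/(integral t s) -/(integral t u) => -[ts tu].
have value_map (v : seq (M * restrict_scalars j)) :
    value t [seq (f p.1, p.2) | p <- v] = f (value t v).
  by rewrite /value big_map linear_sum; apply: eq_bigr => p _; rewrite linearZ.
(* Injectivity of [f] equates the values of [s] and [u], so [j t] lies in [E] and hence in [N],
   against the choice of [t]. *)
rewrite !value_map => /injf vE; apply: Nt; apply: EN.
apply: tensor_trans (scale_right_integral ts) _; rewrite vE.
exact: tensor_sym (scale_right_integral tu).
Qed.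

End LocalFlatness.

Theorem theorem21 (A K : comPzRingType) (i : {rmorphism A -> K})
  (hK : is_total_quotient_ring i) (hMarot : marot A) (hP : P_ring i) :
  perinormal i.
Proof.
move=> B j k ov GD; apply: flat_of_multipliers; first by case: ov.
exact: GD_overring_multiplier hK hP ov GD.
Qed.
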